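(* For $k\in\mathbb N=\{1,2,\dots\}$ and $0<\alpha<1$, \[ \sum_{j=0}^k \binom{\alpha k}{\alpha j} x^{\alpha j}y^{\alpha(k-j)}\ge (x+y)^{\alpha k},\qquad x,y\ge 0, \] and for $k\in\mathbb N$ and $\alpha>1$, \[ \sum_{j=0}^k \binom{\alpha k}{\alpha j} x^{\alpha j}y^{\alpha(k-j)}\le (x+y)^{\alpha k},\qquad x,y\ge 0. \] Both inequalities are strict whenever $x>0$ and $y>0$.
   Context: For real $a\ge b\ge 0$, the generalized binomial coefficient is $\binom{a}{b}=\frac{\Gamma(a+1)}{\Gamma(b+1)\Gamma(a-b+1)}$. *)

(* Defs.v *)
From HB Require Import structures.
From mathcomp Require Import all_boot all_order all_algebra.
From mathcomp Require Import all_classical all_reals all_analysis.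
Set Implicit Arguments. Unset Strict Implicit. Unset Printing Implicit Defensive.
Import Order.TTheory GRing.Theory Num.Theory.
Local Open Scope classical_set_scope.
Local Open Scope ring_scope.

Definition Gamma (R : realType) (s : R) : R :=
  fine (\int[@lebesgue_measure R]_(t in `]0%R, +oo[)
          ((t `^ (s - 1)) * expR (- t))%:E)%E.

Definition gbinom (R : realType) (a b : R) : R :=
  Gamma (a + 1) / (Gamma (b + 1) * Gamma (a - b + 1)).

Definition Ssum (R : realType) (alpha x y : R) (k : nat) : R :=
  \sum_(0 <= j < k.+1)
     gbinom (alpha * k%:R) (alpha * j%:R)
       * x `^ (alpha * j%:R) * y `^ (alpha * (k - j)%:R).

(* Main.v *)
Require Import Defs.
From HB Require Import structures.
From mathcomp Require Import all_boot all_order all_algebra.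
From mathcomp Require Import all_classical all_reals all_analysis.
From mathcomp Require Import measurable_realfun ring lra.
Import Order.TTheory GRing.Theory Num.Theory.
Import numFieldNormedType.Exports.
Local Open Scope ring_scope.

(** Put u(s) = s^(alpha-1) / Gamma(alpha) and g_k(t) = t^(alpha k) / Gamma(alpha k + 1).
    The Beta integral says that g_(k+1) is the convolution of u with g_k on [0,t], and
    the claim becomes a comparison of g_k(x+y) with sum_j g_j(x) g_(k-j)(y).  Let
    D_k(x,y) be the difference of the sum and g_k(x+y).  Splitting the convolution for
    g_(k+1)(x+y) at x gives
      D_(k+1)(x,y) = int_0^x u(s) D_k(x-s,y) ds
                     + int_0^y (u(s) - u(x+s)) g_k(y-s) ds,
    so by induction D_k has the sign of u(s) - u(x+s): positive for alpha < 1, where u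
    decreases, and negative for alpha > 1, where u increases. *)

(** * Strict positivity and integrability of nonnegative functions *)

Section integration.
Local Open Scope classical_set_scope.
Local Open Scope ring_scope.

(** A zero integral would make [f] vanish almost everywhere on [D]. As [f] vanishes nowhere on [D],
    the whole of [D] would be a null set. *)
Lemma integral_gt0 d (T : measurableType d) (R : realType)
    (mu : {measure set T -> \bar R}) (D : set T) (f : T -> \bar R) :
  measurable D -> (0 < mu D)%E -> measurable_fun D f ->
  (forall x, D x -> 0 < f x)%E -> (0 < \int[mu]_(x in D) f x)%E.
Proof.
move=> mD muD mf f0.
rewrite lt0e integral_ge0 ?andbT; last by move=> x /f0/ltW.
apply/eqP => int0.
have /(ae_eq_integral_abs mu mD mf) : (\int[mu]_(x in D) `|f x| = 0)%E.
  by rewrite -[RHS]int0; apply: eq_integral => x /set_mem/f0/ltW/gee0_abs.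
move=> [N [mN N0 DN]].
suff : (mu D <= mu N)%E by rewrite N0 leNgt muD.
apply: le_measure; rewrite ?inE// => x Dx; apply: DN => /= /(_ Dx) fx0.
by have := f0 x Dx; rewrite fx0 ltxx.
Qed.

Lemma ge0_integrable d (T : measurableType d) (R : realType)
    (mu : {measure set T -> \bar R}) (D : set T) (f : T -> R) :
  measurable_fun D f -> (forall x, D x -> 0 <= f x) ->
  (\int[mu]_(x in D) (f x)%:E < +oo)%E -> mu.-integrable D (EFin \o f).
Proof.
move=> mf f0 foo; apply/integrableP; split; first exact/measurable_EFinP.
rewrite (eq_integral (fun x => (f x)%:E))// => x /set_mem Dx /=.
by rewrite ger0_norm// f0.
Qed.

End integration.

(** * Affine substitution in Lebesgue integrals *)

Section affine_change_of_variable.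
Local Open Scope classical_set_scope.
Local Open Scope ring_scope.
Context {R : realType}.
Notation mu := (@lebesgue_measure R).
Variables (a c : R) (a0 : 0 < a).

Let affine : measurableTypeR R -> measurableTypeR R := fun x => a * x + c.

Let measurable_affine : measurable_fun [set: measurableTypeR R] affine.
Proof. by apply: measurable_funD => //; exact: measurable_funM. Qed.

Let scaled : {measure set measurableTypeR R -> \bar R} :=
  mscale (NngNum (ltW a0))
    (measure_function_pushforward__canonical__measure_function_Measure
       mu measurable_affine).

(** The right-hand side is the measure [scaled]. The preimage of []p, q]] has length [(q - p) / a],
    so [scaled] gives it the value [q - p], and uniqueness of Lebesgue measure applies. *)
Lemma lebesgue_measure_affine (A : set (measurableTypeR R)) : measurable A ->
  mu A = (a%:E * mu ((fun x => a * x + c)%R @^-1` A))%E.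
Proof.
move=> mA; rewrite (@lebesgue_measure_unique R scaled)//= => _ [[p q]] _ <-.
rewrite /scaled /mscale /pushforward/=.
have eqI : affine @^-1` `]p, q]%classic = `](p - c) / a, (q - c) / a]%classic.
  apply/seteqP; split=> x /=;
    by rewrite !in_itv/= /affine ltr_pdivrMr// ler_pdivlMr// ltrBlDr lerBrDr (mulrC a).
rewrite [X in (_ * mu X)%E]eqI.
rewrite !lebesgue_measure_itv/= !lte_fin ltr_pM2r ?invr_gt0// ltrD2r.
case: ifPn => _; last by rewrite mule0.
by rewrite -!EFinD -EFinM -mulrBl mulrC divfK ?gt_eqF//; congr (_%:E); ring.
Qed.

Lemma ge0_integral_affine (D : set R) (f : R -> \bar R) :
  measurable D -> measurable_fun D f -> (forall x, D x -> (0 <= f x)%E) ->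
  (\int[mu]_(x in D) f x =
   a%:E * \int[mu]_(x in (fun x => (a * x + c)%R) @^-1` D) f (a * x + c)%R)%E.
Proof.
move=> mD mf f0.
rewrite (eq_measure_integral scaled); last first.
  by move=> A mA _; exact: lebesgue_measure_affine.
rewrite ge0_integral_mscale//= ge0_integral_pushforward//.
by move=> x /set_mem; exact: f0.
Qed.

End affine_change_of_variable.

(** * Convergence and positivity of the Gamma integral *)

Section gamma_function.
Local Open Scope classical_set_scope.
Local Open Scope ring_scope.
Context {R : realType}.
Notation mu := (@lebesgue_measure R).

(** (t / (1 + t))^s / s is bounded on ]0, +oo[, and up to a constant its derivative
    t^(s-1) (1 + t)^(-s-1) dominates the integrand of Gamma s. *)
Let majorant (s t : R) : R :=
  expR (s * (ln t - ln (1 + t))) * (t^-1 - (1 + t)^-1).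

Let primitive (s t : R) : R := s^-1 * expR (s * (ln t - ln (1 + t))).

Let is_derive_ln_ratio (t : R) : 0 < t ->
  is_derive t 1 (fun t => ln t - ln (1 + t)) (t^-1 - (1 + t)^-1).
Proof.
move=> t0; have t1 : 0 < 1 + t by lra.
apply: is_deriveB; first exact: is_derive1_ln.
have -> : (1 + t)^-1 = (1 + t)^-1 * (0 + 1) :> R by ring.
apply: is_derive1_comp.
by have := is_derive1_ln t1.
Qed.

Let is_derive_expR_ln_ratio (s t : R) : 0 < t ->
  is_derive t 1 (fun t => expR (s * (ln t - ln (1 + t))))
    (expR (s * (ln t - ln (1 + t))) * (s * (t^-1 - (1 + t)^-1))).
Proof.
by move=> t0; have dl := is_derive_ln_ratio t t0; exact: (@is_derive1_comp _ expR).
Qed.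

Let is_derive_primitive (s t : R) : 0 < s -> 0 < t ->
  is_derive t 1 (primitive s) (majorant s t).
Proof.
move=> s0 t0; have de := is_derive_expR_ln_ratio s t t0.
have -> : majorant s t =
    s^-1 * (expR (s * (ln t - ln (1 + t))) * (s * (t^-1 - (1 + t)^-1))).
  by rewrite /majorant; field; lra.
exact: is_deriveZ.
Qed.

Let derivable_majorant (s t : R) : 0 < t -> derivable (majorant s) t 1.
Proof.
move=> t0; have de := is_derive_expR_ln_ratio s t t0.
by apply: derivableM; [exact: ex_derive|apply: derivableB; apply: derivableV => //; lra].
Qed.

(** After taking logarithms the powers of [t] cancel, and what remains is [(s + 1) * ln z <= 1 + t]
    with [z = (1 + t) / (s + 1)], that is, [ln z <= z]. This is where the constant comes from. *)
Let le_majorant (s t : R) : 0 < s -> 0 < t ->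
  t `^ (s - 1) * expR (- t) <=
  expR ((s + 1) * ln (s + 1) + 1) * majorant s t.
Proof.
move=> s0 t0; have s1 : 0 < s + 1 by lra.
have t1 : 0 < 1 + t by lra.
(* The second factor of [majorant] is [1 / (t * (1 + t))], so the product is a single
   exponential. *)
have E : majorant s t = expR (s * ln t - s * ln (1 + t) - ln t - ln (1 + t)).
  have -> : s * ln t - s * ln (1 + t) - ln t - ln (1 + t) =
    s * (ln t - ln (1 + t)) - ln (t * (1 + t)) by rewrite lnM ?posrE//; ring.
  rewrite expRD expRN lnK ?posrE ?mulr_gt0// /majorant; congr (_ * _).
  by field; lra.
rewrite E /powR gt_eqF// -!expRD ler_expR.
have := ltW (ln_sublinear (divr_gt0 t1 s1)).
by rewrite ln_div ?posrE// ler_pdivlMr//; nra.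
Qed.

Let majorant_ge0 (s t : R) : 0 < t -> 0 <= majorant s t.
Proof.
move=> t0; rewrite mulr_ge0 ?expR_ge0// subr_ge0 lef_pV2 ?posrE//; lra.
Qed.

(** The integral is an increment of [primitive s], whose values lie between 0 and [s^-1] because
    [t < 1 + t]. The bound is uniform in [a] and [b]. *)
Let integral_majorant_le (s a b : R) : 0 < s -> 0 < a -> a < b ->
  (\int[mu]_(t in `[a, b]) (majorant s t)%:E <= (s^-1)%:E)%E.
Proof.
move=> s0 a0 ab.
have pos t : t \in `[a, b] -> 0 < t by rewrite in_itv/= => /andP[]; lra.
have posoo t : t \in `]a, b[ -> 0 < t by rewrite in_itv/= => /andP[]; lra.
have dP t : 0 < t -> derivable (primitive s) t 1.
  by move=> t0; have dp := is_derive_primitive s t s0 t0; exact: ex_derive.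
have cP : {within `[a, b], continuous (primitive s)}.
  by apply: derivable_within_continuous => t /pos; exact: dP.
rewrite (@continuous_FTC2 _ _ (primitive s))//.
- rewrite -EFinB lee_fin.
  have E u : 0 < u -> 0 <= primitive s u <= s^-1.
    move=> u0; apply/andP; split; first by rewrite mulr_ge0 ?expR_ge0// invr_ge0 ltW.
    rewrite ler_piMr ?invr_ge0 ?(ltW s0)// -[leRHS]expR0 ler_expR pmulr_rle0// subr_le0.
    by rewrite ler_ln ?posrE//; lra.
  have /andP[_ ?] := E b (lt_trans a0 ab).
  have /andP[? _] := E a a0.
  lra.
- by apply: derivable_within_continuous => t /pos; exact: derivable_majorant.
- have [_ ra lb] := (continuous_within_itvP _ ab).1 cP.
  by split => // t /posoo; exact: dP.
- move=> t /posoo t0; rewrite derive1E.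
  by have dp := is_derive_primitive s t s0 t0; rewrite derive_val.
Qed.

Lemma measurable_gamma_integrand (s : R) D :
  measurable_fun D (fun t : R => t `^ (s - 1) * expR (- t)).
Proof.
apply: measurable_funTS; apply: measurable_funM => //.
exact: measurableT_comp.
Qed.

(** The half-line is exhausted by compact intervals. On each of them the integral is at most
    [C * s^-1], and monotone convergence carries this bound to the limit. *)
Lemma integral_gamma_lty (s : R) : 0 < s ->
  (\int[mu]_(t in `]0%R, +oo[) (t `^ (s - 1) * expR (- t))%:E < +oo)%E.
Proof.
move=> s0; pose C := expR ((s + 1) * ln (s + 1) + 1).
(* Starting from 2 keeps the endpoints distinct already at [n = 0], as [integral_majorant_le]
   requires. *)
pose I (n : nat) : set R := `[n.+2%:R^-1, n.+2%:R]%classic.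
have I0 n x : I n x -> 0 < x.
  by rewrite /I/= in_itv/= => /andP[+ _]; apply: lt_le_trans; rewrite invr_gt0.
have -> : `]0, +oo[%classic = \bigcup_n I n.
  apply/seteqP; split=> [x|x [n _ /I0]] /=; last by rewrite in_itv/= andbT.
  rewrite in_itv/= andbT => x0.
  exists (Num.truncn (Num.max x x^-1)) => //; rewrite /I/= in_itv/=.
  have := truncnS_gt (Num.max x x^-1); set n := Num.truncn _.
  rewrite gt_max => /andP[xn xVn].
  have nn : n.+1%:R <= n.+2%:R :> R by rewrite ler_nat.
  apply/andP; split; last by lra.
  by rewrite -[leRHS]invrK lef_pV2 ?posrE ?invr_gt0//; lra.
have mgE D : measurable_fun D (fun t : R => (t `^ (s - 1) * expR (- t))%:E).
  by apply/measurable_EFinP; exact: measurable_gamma_integrand.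
have ndI : nondecreasing_seq I.
  move=> m n mn; apply/subsetPset => x; rewrite /I/= !in_itv/= => /andP[h1 h2].
  apply/andP; split.
    by apply: le_trans h1; rewrite lef_pV2 ?posrE// ler_nat !ltnS.
  by apply: le_trans h2 _; rewrite ler_nat !ltnS.
have g0 n x : I n x -> (0 <= (x `^ (s - 1) * expR (- x))%:E)%E.
  by move=> _; rewrite lee_fin mulr_ge0 ?powR_ge0 ?expR_ge0.
have mI n : measurable (I n : set (measurableTypeR R)) by exact: measurable_itv.
apply: (@le_lt_trans _ _ (C * s^-1)%:E); last exact: ltry.
rewrite -(cvg_lim _ (@ge0_nondecreasing_set_cvg_integral _ (measurableTypeR R) R I
  (fun t => (t `^ (s - 1) * expR (- t))%:E) mu ndI mI (fun n => mgE (I n)) g0))//.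
apply: lime_le.
  apply: ereal_nondecreasing_is_cvgn.
  apply: ge0_nondecreasing_set_nondecreasing_integral => // n; exact: mgE.
apply: nearW => n.
have mM : measurable_fun (I n) (majorant s).
  apply: subspace_continuous_measurable_fun; first exact: measurable_itv.
  by apply: derivable_within_continuous => t /I0; exact: derivable_majorant.
apply: (@le_trans _ _ (\int[mu]_(t in I n) (C * majorant s t)%:E)%E).
  apply: ge0_le_integral => //.
  - exact: g0.
  - exact: mgE.
  - by apply/measurable_EFinP; exact: measurable_funM.
  - by move=> x /I0 x0; rewrite lee_fin; exact: le_majorant.
under eq_integral do rewrite EFinM.
rewrite ge0_integralZl//; last 3 first.
- by apply/measurable_EFinP.
- by move=> x /I0 x0; rewrite lee_fin majorant_ge0.
- by rewrite lee_fin expR_ge0.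
rewrite EFinM lee_pmul2l// ?lte_fin ?expR_gt0//.
apply: integral_majorant_le => //; rewrite ?invr_gt0//.
by rewrite (@le_lt_trans _ _ 1) ?invf_le1 ?ler1n ?ltr1n.
Qed.

(** [Gamma] is defined through [fine], which loses nothing once the integral is known to be
    finite. *)
Lemma EFin_Gamma (s : R) : 0 < s ->
  (Gamma s)%:E = (\int[mu]_(t in `]0%R, +oo[) (t `^ (s - 1) * expR (- t))%:E)%E.
Proof.
move=> s0; rewrite fineK// ge0_fin_numE ?integral_gamma_lty//.
by apply: integral_ge0 => x _; rewrite lee_fin mulr_ge0 ?powR_ge0 ?expR_ge0.
Qed.

Lemma Gamma_gt0 (s : R) : 0 < s -> 0 < Gamma s.
Proof.
move=> s0; rewrite -lte_fin EFin_Gamma//; apply: integral_gt0 => //=.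
- by rewrite lebesgue_measure_itv/= ltry sube0 ltry.
- by apply/measurable_EFinP; exact: measurable_gamma_integrand.
- move=> x; rewrite in_itv/= andbT => x0.
  by rewrite lte_fin mulr_gt0 ?powR_gt0 ?expR_gt0.
Qed.

(** At [s = 1] the integrand is the density of the exponential law of rate 1, whose total mass is
    1. *)
Lemma Gamma1 : Gamma 1 = 1 :> R.
Proof.
apply: EFin_inj; rewrite EFin_Gamma// -(integral_exponential_pdf ltr01).
rewrite integral_itv_obnd_cbnd; last first.
  by apply/measurable_EFinP; exact: measurable_gamma_integrand.
rewrite integral_mkcond; apply: eq_integral => x _.
rewrite /exponential_pdf !patchE; case: ifP => // _.
by rewrite subrr powRr0 mulN1r.
Qed.

End gamma_function.

(** * The Beta integral as a convolution of truncated powers *)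

Section beta_integral.
Local Open Scope classical_set_scope.
Local Open Scope ring_scope.
Context {R : realType}.
Notation mu := (@lebesgue_measure R).

(** The indicator discards the default values of [powR] at bases that are not positive. Integrals
    then run over the whole line, so that substitution and Tonelli need no bookkeeping of
    domains. *)
Let w (a s : R) : R := s `^ (a - 1) * \1_(`]0, +oo[) s.

Let w_gt0 a s : 0 < s -> w a s = s `^ (a - 1).
Proof. by move=> s0; rewrite /w indicE mem_set ?mulr1//= in_itv/= andbT. Qed.

Let w_le0 a s : s <= 0 -> w a s = 0.
Proof.
by move=> s0; rewrite /w indicE memNset ?mulr0//= in_itv/= andbT ltNge s0.
Qed.

Let w_ge0 a s : 0 <= w a s.
Proof. by rewrite mulr_ge0 ?powR_ge0// indicE. Qed.

Let measurable_w a : measurable_fun [set: measurableTypeR R] (w a).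
Proof.
apply: measurable_funM; first exact: measurable_powR.
exact: measurable_indic.
Qed.

Let wE a s : w a s = ((fun s => s `^ (a - 1)) \_ `]0, +oo[) s.
Proof. by rewrite /w patchE indicE; case: ifP; rewrite ?mulr1 ?mulr0. Qed.

Let EFin_Gamma_w a : 0 < a ->
  (Gamma a)%:E = (\int[mu]_s (w a s * expR (- s))%:E)%E.
Proof.
move=> a0; rewrite EFin_Gamma// integral_mkcond; apply: eq_integral => s _.
by rewrite wE !patchE; case: ifP; rewrite ?mul0r.
Qed.

(** The value stays in the extended reals, since finiteness only follows from [Gamma_conv]. *)
Let conv (a b t : R) : \bar R := (\int[mu]_s (w a s * w b (t - s))%:E)%E.

Let measurable_conv a b t : measurable_fun [set: measurableTypeR R]
  (fun s => w a s * w b (t - s)).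
Proof.
apply: measurable_funM; first exact: measurable_w.
apply: (measurableT_comp (measurable_w b)).
exact: measurable_funB.
Qed.

Let conv_le0 a b t : t <= 0 -> conv a b t = 0%E.
Proof.
move=> t0; apply: integral0_eq => s _; have [s0|s0] := leP s 0.
  by rewrite w_le0// mul0r.
by rewrite [w b _]w_le0 ?mulr0//; lra.
Qed.

Let w_scale a t s : 0 < t -> w a (t * s) = t `^ (a - 1) * w a s.
Proof.
move=> t0; have [s0|s0] := leP s 0; last by rewrite !w_gt0 ?mulr_gt0// powRM// ltW.
by rewrite !w_le0 ?mulr0// pmulr_rle0.
Qed.

(** Substitute [t * s] for [s]: the two factors are homogeneous of degrees [a - 1] and [b - 1], and
    the Jacobian contributes one more power of [t]. *)
Let conv_scale a b t : 0 < t -> conv a b t = ((t `^ (a + b - 1))%:E * conv a b 1)%E.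
Proof.
move=> t0; rewrite /conv (ge0_integral_affine t 0 t0)//; last 2 first.
- by apply/measurable_EFinP; exact: measurable_conv.
- by move=> s _; rewrite lee_fin mulr_ge0.
have mc c : measurable_fun [set: measurableTypeR R]
    (fun s => (w a s * w b (c - s))%:E).
  by apply/measurable_EFinP; exact: measurable_conv.
have c0 c s : [set: measurableTypeR R] s -> (0 <= (w a s * w b (c - s))%:E)%E.
  by rewrite lee_fin mulr_ge0.
rewrite preimage_setT -!ge0_integralZl_EFin ?(ltW t0) ?powR_ge0//.
- apply: eq_integral => s _; rewrite addr0 -!EFinM; congr EFin.
  have -> : t - t * s = t * (1 - s) by ring.
  rewrite !w_scale//.
  have -> : t `^ (a + b - 1) = t * (t `^ (a - 1) * t `^ (b - 1)).
    rewrite -{2}(powRr1 (ltW t0)) -!powRD ?(gt_eqF t0) ?implybT//.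
    by congr (_ `^ _); ring.
  ring.
- by move=> s; exact: c0.
- by move=> s _; exact: c0.
- apply/measurable_EFinP; apply: (measurableT_comp (measurable_conv a b t)).
  by apply: measurable_funD => //; exact: measurable_funM.
Qed.

(** Tonelli: the convolution of w_a e^- and w_b e^- is t |-> e^-t (w_a * w_b)(t), and by
    scaling w_a * w_b is a multiple of w_(a+b). *)
Let Gamma_conv a b : 0 < a -> 0 < b ->
  (Gamma a * Gamma b)%:E = ((Gamma (a + b))%:E * conv a b 1)%E.
Proof.
move=> a0 b0.
have mwe c : measurable_fun [set: measurableTypeR R] (fun s => w c s * expR (- s)).
  apply: measurable_funM; first exact: measurable_w.
  exact: measurableT_comp.
have we0 c s : 0 <= w c s * expR (- s) by rewrite mulr_ge0 ?expR_ge0.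
pose h (s t : R) : R := (w a s * expR (- s)) * (w b (t - s) * expR (- (t - s))).
transitivity (\int[mu]_s \int[mu]_t (h s t)%:E)%E.
  rewrite EFinM (EFin_Gamma_w a)// -ge0_integralZr//; last 3 first.
  - by apply/measurable_EFinP; exact: mwe.
  - by move=> s _; rewrite lee_fin.
  - by rewrite lee_fin ltW ?Gamma_gt0.
  apply: eq_integral => s _.
  rewrite (EFin_Gamma_w b)// (ge0_integral_affine 1 (- s) ltr01)//; last 2 first.
  - by apply/measurable_EFinP; exact: mwe.
  - by move=> t _; rewrite lee_fin.
  rewrite mul1e preimage_setT -ge0_integralZl_EFin//.
  - by apply: eq_integral => t _; rewrite mul1r -EFinM.
  - by move=> t _; rewrite lee_fin.
  - apply/measurable_EFinP; apply: (measurableT_comp (mwe b)).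
    by apply: measurable_funD => //; exact: measurable_funM.
rewrite (@fubini_tonelli _ _ _ _ R mu mu (fun z => (h z.1 z.2)%:E)); last 2 first.
- apply/measurable_EFinP; apply: measurable_funM.
    exact: (measurableT_comp (mwe a) measurable_fst).
  apply: (measurableT_comp (mwe b)).
  by apply: measurable_funB; [exact: measurable_snd|exact: measurable_fst].
- by move=> z; rewrite lee_fin mulr_ge0.
have K0 : (0 <= conv a b 1)%E.
  by apply: integral_ge0 => s _; rewrite lee_fin mulr_ge0.
rewrite EFin_Gamma_w ?addr_gt0// -ge0_integralZr//; last 2 first.
- by apply/measurable_EFinP; exact: mwe.
- by move=> s _; rewrite lee_fin.
apply: eq_integral => t _ /=.
transitivity ((expR (- t))%:E * conv a b t)%E.
  rewrite -ge0_integralZl_EFin ?expR_ge0//; last 2 first.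
  - by move=> s _; rewrite lee_fin mulr_ge0.
  - by apply/measurable_EFinP; exact: measurable_conv.
  apply: eq_integral => s _; rewrite -EFinM; congr EFin.
  have -> : expR (- t) = expR (- s) * expR (- (t - s)).
    by rewrite -expRD; congr expR; ring.
  rewrite /h; ring.
have [t0|t0] := leP t 0; first by rewrite conv_le0// w_le0// mul0r mul0e mule0.
by rewrite conv_scale// w_gt0// muleA -EFinM mulrC.
Qed.

(** The integrand of [conv a b t] vanishes outside []0, t[]. Scaling reduces to [t = 1], and there
    [Gamma_conv] can be divided by [Gamma (a + b)], which is positive. *)
Lemma integral_beta (a b t : R) : 0 < a -> 0 < b -> 0 < t ->
  (\int[mu]_(s in `]0%R, t[) (s `^ (a - 1) * (t - s) `^ (b - 1))%:E)%E =
  (Gamma a * Gamma b / Gamma (a + b) * t `^ (a + b - 1))%:E.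
Proof.
move=> a0 b0 t0.
transitivity (conv a b t).
  rewrite integral_mkcond; apply: eq_integral => s _.
  rewrite patchE; case: ifP.
    by move=> /set_mem/=; rewrite in_itv/= => /andP[s0 st]; rewrite !w_gt0// subr_gt0.
  move=> /negbT; rewrite notin_setE/= in_itv/= => /negP.
  rewrite negb_and -!leNgt => /orP[s0|ts]; first by rewrite w_le0// mul0r.
  by rewrite [w b _]w_le0 ?mulr0// subr_le0.
have G0 := Gamma_gt0 _ (addr_gt0 a0 b0).
have K1 : conv a b 1 = (Gamma a * Gamma b / Gamma (a + b))%:E.
  rewrite mulrC EFinM Gamma_conv// muleA -EFinM mulVf ?mul1e// gt_eqF//.
by rewrite conv_scale// K1 -EFinM mulrC.
Qed.

End beta_integral.

(** * Recursion and sign of the defect, for abstract [u] and [g] *)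

Section convolution_defect.
Local Open Scope classical_set_scope.
Local Open Scope ring_scope.
Context {R : realType}.
Notation mu := (@lebesgue_measure R).
Variables (u : R -> R) (g : nat -> R -> R).
Hypothesis u_ge0 : forall s, 0 <= u s.
Hypothesis g_ge0 : forall k t, 0 <= g k t.
Hypothesis measurable_u : measurable_fun [set: measurableTypeR R] u.
Hypothesis measurable_g : forall k, measurable_fun [set: measurableTypeR R] (g k).
Hypothesis g0 : forall t, g 0 t = 1.
(** With half-open intervals, []0, x]] and []x, x + y]] partition []0, x + y]], and [t = 0] gives an
    empty domain. *)
Hypothesis integral_ug : forall k (t : R), 0 <= t ->
  (\int[mu]_(s in `]0%R, t]) (u s * g k (t - s))%:E = (g k.+1 t)%:E)%E.

Let measurable_u_shift D c :
  measurable_fun D (fun s : measurableTypeR R => u (c + s)).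
Proof.
apply: measurable_funTS; apply: (measurableT_comp measurable_u).
exact: measurable_funD.
Qed.

Let measurable_gB D k t :
  measurable_fun D (fun s : measurableTypeR R => g k (t - s)).
Proof.
apply: measurable_funTS; apply: (measurableT_comp (measurable_g k)).
exact: measurable_funB.
Qed.

Let measurable_ug D k t :
  measurable_fun D (fun s : measurableTypeR R => u s * g k (t - s)).
Proof.
by apply: measurable_funM; [exact: measurable_funTS|exact: measurable_gB].
Qed.

Let integrable_ug k t : 0 <= t ->
  mu.-integrable `]0, t] (EFin \o (fun s => u s * g k (t - s))).
Proof.
move=> t0; apply: ge0_integrable; first exact: measurable_ug.
  by move=> s _; rewrite mulr_ge0.
by rewrite integral_ug// ltry.
Qed.

Let integral_u_shift_g k x y : 0 <= x -> 0 <= y ->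
  (\int[mu]_(s in `]x, (x + y)%R]) (u s * g k (x + y - s))%:E =
   \int[mu]_(s in `]0%R, y]) (u (x + s) * g k (y - s))%:E)%E.
Proof.
move=> x0 y0; rewrite (ge0_integral_affine 1 x ltr01)//; last 2 first.
- by apply/measurable_EFinP; exact: measurable_ug.
- by move=> s _; rewrite lee_fin mulr_ge0.
have -> : (fun s : R => 1 * s + x) @^-1` `]x, x + y]%classic = `]0, y]%classic.
  apply/seteqP; split=> s /=;
    by rewrite !in_itv/= mul1r ltrDr addrC lerD2l.
rewrite mul1e; apply: eq_integral => s _.
by rewrite mul1r (addrC s) (_ : x + y - (x + s) = y - s)//; ring.
Qed.

Definition defect k x y := \sum_(0 <= j < k.+1) g j x * g (k - j)%N y - g k (x + y).

(** Convolving with [u] in the first variable raises each index [j] by one, the factor in [y] being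
    constant. The finite value also yields integrability of the sum. *)
Let integral_u_sum k x y : 0 <= x ->
  (\int[mu]_(s in `]0%R, x])
     (u s * \sum_(0 <= j < k.+1) g j (x - s) * g (k - j)%N y)%:E =
   (\sum_(0 <= j < k.+1) g j.+1 x * g (k - j)%N y)%:E)%E.
Proof.
move=> x0; rewrite -sumEFin.
under eq_integral do rewrite mulr_sumr -sumEFin.
rewrite ge0_integral_sum//.
- apply: eq_bigr => j _; rewrite EFinM -integral_ug// muleC -ge0_integralZl_EFin//.
  + by apply: eq_integral => s _; rewrite -EFinM; congr EFin; ring.
  + by move=> s _; rewrite lee_fin mulr_ge0.
  + by apply/measurable_EFinP; exact: measurable_ug.
- move=> j; apply/measurable_EFinP.
  apply: measurable_funM; first exact: measurable_funTS.
  by apply: measurable_funM => //; exact: measurable_gB.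
- by move=> j s _; rewrite lee_fin !mulr_ge0.
Qed.

Let integrable_u_sum k x y : 0 <= x ->
  mu.-integrable `]0, x]
    (EFin \o (fun s => u s * \sum_(0 <= j < k.+1) g j (x - s) * g (k - j)%N y)).
Proof.
move=> x0; apply: ge0_integrable.
- apply: measurable_funM; first exact: measurable_funTS.
  apply: measurable_sum => j.
  by apply: measurable_funM => //; exact: measurable_gB.
- by move=> s _; rewrite mulr_ge0// sumr_ge0// => j _; rewrite mulr_ge0.
- by rewrite integral_u_sum// ltry.
Qed.

Let integrable_ug_left k x y : 0 <= x -> 0 <= y ->
  mu.-integrable `]0, x] (EFin \o (fun s => u s * g k (x + y - s))).
Proof.
move=> x0 y0; apply: integrableS (integrable_ug k (x + y) (addr_ge0 x0 y0)) => //.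
by apply: subset_itvl; rewrite bnd_simp lerDl.
Qed.

Let integrable_u_shift_g k x y : 0 <= x -> 0 <= y ->
  mu.-integrable `]0, y] (EFin \o (fun s => u (x + s) * g k (y - s))).
Proof.
move=> x0 y0.
have ixy : mu.-integrable `]x, x + y] (EFin \o (fun s => u s * g k (x + y - s))).
  apply: integrableS (integrable_ug k (x + y) (addr_ge0 x0 y0)) => //.
  by apply: subset_itvr; rewrite bnd_simp.
apply: ge0_integrable.
- by apply: measurable_funM; [exact: measurable_u_shift|exact: measurable_gB].
- by move=> s _; rewrite mulr_ge0.
- by rewrite -integral_u_shift_g//; apply: integrable_lty ixy.
Qed.

Let integrable_defect_left k x y : 0 <= x -> 0 <= y ->
  mu.-integrable `]0, x] (EFin \o (fun s => u s * defect k (x - s) y)).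
Proof.
move=> x0 y0.
have := @integrableB _ (measurableTypeR R) R mu _ (measurable_itv _) _ _
  (integrable_u_sum k x y x0) (integrable_ug_left k x y x0 y0).
apply: eq_integrable => // s _ /=; rewrite -EFinB -mulrBr /defect.
by rewrite [x - s + y]addrAC.
Qed.

Let integrable_defect_right k x y : 0 <= x -> 0 <= y ->
  mu.-integrable `]0, y] (EFin \o (fun s => (u s - u (x + s)) * g k (y - s))).
Proof.
move=> x0 y0.
have := @integrableB _ (measurableTypeR R) R mu _ (measurable_itv _) _ _
  (integrable_ug k y y0) (integrable_u_shift_g k x y x0 y0).
by apply: eq_integrable => // s _ /=; rewrite -EFinB -mulrBl.
Qed.

(** By [integral_u_sum] the first integral supplies every term of the new sum except [j = 0], minus
    the part over []0, x]] of the convolution for [g k.+1 (x + y)]. The second supplies the missing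
    term [g k.+1 y] minus the rest of that convolution, translated to []0, y]]. *)
Let defectS k x y : 0 <= x -> 0 <= y ->
  defect k.+1 x y = \int[mu]_(s in `]0, x]) (u s * defect k (x - s) y) +
                    \int[mu]_(s in `]0, y]) ((u s - u (x + s)) * g k (y - s)).
Proof.
move=> x0 y0; have xy0 := addr_ge0 x0 y0.
have RE t : 0 <= t -> \int[mu]_(s in `]0, t]) (u s * g k (t - s)) = g k.+1 t.
  by move=> t0; rewrite /Rintegral integral_ug.
have -> : \int[mu]_(s in `]0, x]) (u s * defect k (x - s) y) =
    \sum_(0 <= j < k.+1) g j.+1 x * g (k - j)%N y -
    \int[mu]_(s in `]0, x]) (u s * g k (x + y - s)).
  have <- : \int[mu]_(s in `]0, x])
      (u s * \sum_(0 <= j < k.+1) g j (x - s) * g (k - j)%N y) =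
      \sum_(0 <= j < k.+1) g j.+1 x * g (k - j)%N y.
    by rewrite /Rintegral integral_u_sum.
  rewrite -RintegralB//; last 2 first.
  - exact: integrable_u_sum.
  - exact: integrable_ug_left.
  by apply: eq_Rintegral => s _; rewrite -mulrBr /defect [x - s + y]addrAC.
have -> : \int[mu]_(s in `]0, y]) ((u s - u (x + s)) * g k (y - s)) =
    g k.+1 y - \int[mu]_(s in `]0, y]) (u (x + s) * g k (y - s)).
  rewrite -(RE y y0) -RintegralB//; last 2 first.
  - exact: integrable_ug.
  - exact: integrable_u_shift_g.
  by apply: eq_Rintegral => s _; rewrite -mulrBl.
have -> : \int[mu]_(s in `]0, y]) (u (x + s) * g k (y - s)) =
    g k.+1 (x + y) - \int[mu]_(s in `]0, x]) (u s * g k (x + y - s)).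
  rewrite -(RE (x + y) xy0) Rintegral_itvB ?bnd_simp ?lerDl//.
    by rewrite /Rintegral -integral_u_shift_g.
  exact: integrable_ug.
(* The term [j = 0] is [g k.+1 y], because [g 0] is constantly 1. *)
rewrite {1}/defect big_nat_recl// g0 subn0.
under eq_bigr do rewrite subSS.
ring.
Qed.

(** Taking e = 1 or e = -1 covers decreasing and increasing u at once. *)
Variable e : R.
Hypothesis u_shift : forall x s : R, 0 < x -> 0 < s -> 0 < e * (u s - u (x + s)).

Let u_shift_ge0 x s : 0 <= x -> 0 < s -> 0 <= e * (u s - u (x + s)).
Proof.
rewrite le_eqVlt => /predU1P[<-|x0] s0; last by rewrite ltW// u_shift.
by rewrite add0r subrr mulr0.
Qed.

(** Induction on [k] for all [x] and [y], since the recursion evaluates the previous defect at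
    [x - s]. For [k = 0] the defect is zero. *)
Lemma defect_ge0 k x y : 0 <= x -> 0 <= y -> 0 <= e * defect k x y.
Proof.
elim: k x y => [|k IH] x y x0 y0.
  by rewrite /defect big_nat1 !g0 mul1r subrr mulr0.
rewrite defectS// mulrDr -!RintegralZl//; last 2 first.
- exact: integrable_defect_right.
- exact: integrable_defect_left.
rewrite addr_ge0// Rintegral_ge0// => s /=; rewrite in_itv/= => /andP[s0 sx].
  by rewrite mulrCA mulr_ge0// IH// subr_ge0.
by rewrite mulrA mulr_ge0// u_shift_ge0.
Qed.

Hypothesis g_gt0 : forall k (t : R), 0 < t -> 0 < g k t.

(** No further induction is required: the first integral of [defectS] is nonnegative by
    [defect_ge0], and strictness comes from the second alone. *)
Lemma defect_gt0 k x y : (0 < k)%N -> 0 < x -> 0 < y -> 0 < e * defect k x y.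
Proof.
case: k => [//|k] _ x0 y0.
rewrite defectS ?ltW// mulrDr -!RintegralZl//; last 2 first.
- by apply: integrable_defect_right; exact: ltW.
- by apply: integrable_defect_left; exact: ltW.
rewrite ltr_wpDl//.
  apply: Rintegral_ge0 => s /=; rewrite in_itv/= => /andP[s0 sx].
  by rewrite mulrCA mulr_ge0// defect_ge0// ?subr_ge0// ltW.
set f := fun s => e * ((u s - u (x + s)) * g k (y - s)).
have intf' : mu.-integrable `]0, y] (EFin \o f).
  have := @integrableZl _ (measurableTypeR R) R mu _ (measurable_itv _) e _
    (integrable_defect_right k x y (ltW x0) (ltW y0)).
  by apply: eq_integrable => // s _ /=; rewrite -EFinM.
have intf : mu.-integrable `]0, y[ (EFin \o f).
  apply: integrableS intf' => //.
  by apply: subset_itvl; rewrite bnd_simp.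
(* The endpoint [s = y] is removed because [g_gt0] says nothing about [g k 0]. *)
rewrite -Rintegral_itv_bndo_bndc// fine_gt0//; apply/andP; split; last first.
  by apply: integrable_lty intf.
apply: integral_gt0 => //.
- by rewrite /= lebesgue_measure_itv/= lte_fin y0 sube0 lte_fin.
- exact: measurable_int intf.
- move=> s /=; rewrite in_itv/= => /andP[s0 sy]; rewrite lte_fin /f mulrA mulr_gt0//.
    exact: u_shift.
  by rewrite g_gt0// subr_gt0.
Qed.

End convolution_defect.

(** * Normalized powers as an instance of the recursion *)

Section fractional_powers.
Local Open Scope classical_set_scope.
Local Open Scope ring_scope.
Context {R : realType}.
Notation mu := (@lebesgue_measure R).
Variables (alpha : R) (alpha0 : 0 < alpha).

Let u (s : R) : R := s `^ (alpha - 1) / Gamma alpha.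
Let g (k : nat) (t : R) : R := t `^ (alpha * k%:R) / Gamma (alpha * k%:R + 1).

Let exponent_gt0 (k : nat) : 0 < alpha * k%:R + 1.
Proof. by rewrite ltr_wpDl// mulr_ge0// ltW. Qed.

Let u_ge0 s : 0 <= u s.
Proof. by rewrite divr_ge0 ?powR_ge0// ltW// Gamma_gt0. Qed.

Let g_gt0 k t : 0 < t -> 0 < g k t.
Proof. by move=> t0; rewrite divr_gt0 ?powR_gt0// Gamma_gt0. Qed.

Let g_ge0 k t : 0 <= g k t.
Proof. by rewrite divr_ge0 ?powR_ge0// ltW// Gamma_gt0. Qed.

(** This includes [t = 0], where [powR] gives the zeroth power of zero the value 1. *)
Let g0 t : g 0 t = 1.
Proof. by rewrite /g mulr0 powRr0 add0r Gamma1 divr1. Qed.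

Let measurable_u : measurable_fun [set: measurableTypeR R] u.
Proof. by apply: measurable_funM => //; exact: measurable_powR. Qed.

Let measurable_g k : measurable_fun [set: measurableTypeR R] (g k).
Proof. by apply: measurable_funM => //; exact: measurable_powR. Qed.

(** This is the Beta integral with parameters [alpha] and [alpha * k%:R + 1]: its two Gamma factors
    cancel the denominators of [u] and [g k], and its own denominator is that of [g k.+1]. *)
Let integral_ug k t : 0 <= t ->
  (\int[mu]_(s in `]0%R, t]) (u s * g k (t - s))%:E = (g k.+1 t)%:E)%E.
Proof.
rewrite le_eqVlt => /predU1P[<-|t0].
  (* At [t = 0] the domain is empty, and [g k.+1 0] is zero because its exponent is nonzero. *)
  rewrite set_itv_ge ?integral_set0 ?bnd_simp//= /g powR0 ?mul0r//.
  by rewrite mulf_neq0 ?gt_eqF.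
have mg : measurable_fun [set: measurableTypeR R] (fun s => g k (t - s)).
  apply: (measurableT_comp (measurable_g k)); exact: measurable_funB.
rewrite -integral_itv_bndo_bndc; last first.
  by apply/measurable_EFinP; apply: measurable_funTS; exact: measurable_funM.
pose c := (Gamma alpha * Gamma (alpha * k%:R + 1))^-1.
have c0 : 0 <= c by rewrite invr_ge0 mulr_ge0// ltW// Gamma_gt0.
transitivity (c%:E * \int[mu]_(s in `]0%R, t[)
    (s `^ (alpha - 1) * (t - s) `^ (alpha * k%:R + 1 - 1))%:E)%E.
  rewrite -ge0_integralZl_EFin//.
  - apply: eq_integral => s _; rewrite -EFinM addrK; congr EFin.
    by rewrite /u /g /c invfM; ring.
  - by move=> s _; rewrite lee_fin mulr_ge0 ?powR_ge0.
  - apply/measurable_EFinP; apply: measurable_funTS.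
    apply: measurable_funM; first exact: measurable_powR.
    apply: (measurableT_comp (measurable_powR (alpha * k%:R + 1 - 1))).
    exact: measurable_funB.
rewrite integral_beta// -EFinM; congr EFin.
have -> : alpha + (alpha * k%:R + 1) = alpha * k.+1%:R + 1.
  by rewrite -natr1; ring.
have Ga := Gamma_gt0 _ alpha0.
have Gk := Gamma_gt0 _ (exponent_gt0 k).
have GS := Gamma_gt0 _ (exponent_gt0 k.+1).
move: Ga Gk GS; rewrite addrK /g /c.
move: (Gamma alpha) (Gamma (alpha * k%:R + 1)) (Gamma (alpha * k.+1%:R + 1))
  => A B C A0 B0 C0.
by field; rewrite !gt_eqF.
Qed.

(** The factor [Gamma (alpha * k%:R + 1)] is the common numerator of the binomial coefficients, and
    their denominators are those of [g j] and [g (k - j)]. *)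
Lemma Ssum_subE k x y : Ssum alpha x y k - (x + y) `^ (alpha * k%:R) =
  Gamma (alpha * k%:R + 1) * defect g k x y.
Proof.
have G0 := Gamma_gt0 _ (exponent_gt0 k).
rewrite /defect mulrBr; congr (_ - _); last by rewrite /g [RHS]mulrC divfK// gt_eqF.
(* [big_nat] records the bound on [j] under which the truncated [k - j] agrees with real
   subtraction. *)
rewrite /Ssum mulr_sumr [LHS]big_nat [RHS]big_nat.
apply: eq_bigr => j; rewrite ltnS => /= jk.
have E : alpha * k%:R - alpha * j%:R + 1 = alpha * (k - j)%:R + 1.
  by rewrite natrB//; ring.
by rewrite /gbinom /g E invfM; ring.
Qed.

Variable e : R.
Hypothesis powR_shift : forall x s : R, 0 < x -> 0 < s ->
  0 < e * (s `^ (alpha - 1) - (x + s) `^ (alpha - 1)).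

Let u_shift x s : 0 < x -> 0 < s -> 0 < e * (u s - u (x + s)).
Proof.
by move=> x0 s0; rewrite -mulrBl mulrA divr_gt0 ?powR_shift ?Gamma_gt0.
Qed.

Lemma Ssum_sub_ge0 k x y : 0 <= x -> 0 <= y ->
  0 <= e * (Ssum alpha x y k - (x + y) `^ (alpha * k%:R)).
Proof.
move=> x0 y0; rewrite Ssum_subE mulrCA mulr_ge0//; first by rewrite ltW// Gamma_gt0.
by apply: (@defect_ge0 _ u) => //.
Qed.

Lemma Ssum_sub_gt0 k x y : (0 < k)%N -> 0 < x -> 0 < y ->
  0 < e * (Ssum alpha x y k - (x + y) `^ (alpha * k%:R)).
Proof.
move=> k0 x0 y0; rewrite Ssum_subE mulrCA mulr_gt0 ?Gamma_gt0//.
by apply: (@defect_gt0 _ u) => //.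
Qed.

End fractional_powers.

Theorem theorem1p3 (R : realType) (k : nat) (alpha x y : R) :
  (0 < k)%N -> 0 <= x -> 0 <= y ->
  ((0 < alpha < 1 ->
      (x + y) `^ (alpha * k%:R) <= Ssum alpha x y k
      /\ (0 < x -> 0 < y -> (x + y) `^ (alpha * k%:R) < Ssum alpha x y k))
  /\ (1 < alpha ->
      Ssum alpha x y k <= (x + y) `^ (alpha * k%:R)
      /\ (0 < x -> 0 < y -> Ssum alpha x y k < (x + y) `^ (alpha * k%:R)))).
Proof.
move=> k0 x0 y0; split=> [/andP[a0 a1]|a1].
(* Here [e = 1]: the exponent [alpha - 1] is negative, so the power decreases. *)
- have dec z s : 0 < z -> 0 < s ->
      0 < 1 * (s `^ (alpha - 1) - (z + s) `^ (alpha - 1)).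
    move=> z0 s0; have -> : alpha - 1 = - (1 - alpha) by ring.
    rewrite mul1r subr_gt0 !powRN ltf_pV2 ?posrE ?powR_gt0 ?addr_gt0//.
    by apply: gt0_ltr_powR; rewrite ?nnegrE; lra.
  split; first by rewrite -subr_ge0 -[leRHS]mul1r Ssum_sub_ge0.
  by move=> x1 y1; rewrite -subr_gt0 -[ltRHS]mul1r Ssum_sub_gt0.
- have a0 : 0 < alpha by lra.
  (* Here [e = -1]: the exponent [alpha - 1] is positive, so the power increases. *)
  have inc z s : 0 < z -> 0 < s ->
      0 < -1 * (s `^ (alpha - 1) - (z + s) `^ (alpha - 1)).
    move=> z0 s0; rewrite mulN1r opprB subr_gt0.
    by apply: gt0_ltr_powR; rewrite ?nnegrE; lra.
  split; first by rewrite -subr_ge0 -opprB -mulN1r Ssum_sub_ge0.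
  by move=> x1 y1; rewrite -subr_gt0 -opprB -mulN1r Ssum_sub_gt0.
Qed.
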